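(* Let $N\ge 2$ and $1\le k<N$ be integers. (a) For every bounded domain $\Omega\subset\mathbb{R}^N$ and every continuous $H:\Omega\times\mathbb{R}^N\to\mathbb{R}$ such that $|H(x,\xi)|\le b|\xi|$ for all $(x,\xi)\in\Omega\times\mathbb{R}^N$, with some constant $b\ge 0$, the operator $u\mapsto\mathcal{P}^-_k(D^2u)+H(x,\nabla u)$ does not satisfy the strong minimum principle in $\Omega$. (b) If in addition $\Omega\subseteq B_R$ for some $R>0$ with $bR\le k$, then the operator $u\mapsto \mathcal{P}^-_k(D^2u)+H(x,\nabla u)$ satisfies the weak minimum principle in $\Omega$. (c) The condition $bR\le k$ is sharp when $H(x,\xi)=-b|\xi|$: for all $b>0$ and $R>0$ with $bR>k$ there is a bounded domain $\Omega\subset B_R$ such that $u\mapsto\mathcal{P}^-_k(D^2u)-b|\nabla u|$ does not satisfy the weak minimum principle in $\Omega$.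
   Context: For a real symmetric $N\times N$ matrix $X$ with ordered eigenvalues $\lambda_1(X)\le\cdots\le\lambda_N(X)$, $\mathcal{P}^-_k(X)=\sum_{i=1}^k\lambda_i(X)$. $B_R$ is the open ball of radius $R$ centred at the origin. A domain is a nonempty open connected set. Differential inequalities are meant in the viscosity sense: a real-valued function $u$ satisfies $F(x,u,\nabla u,D^2u)\le 0$ in $\Omega$ (supersolution) if $u$ is lower semicontinuous in $\Omega$ and, for every $x\in\Omega$ and every $C^2$ function $\varphi$ touching $u$ from below at $x$ (i.e. $\varphi(x)=u(x)$ and $\varphi\le u$ near $x$), $F(x,u(x),\nabla\varphi(x),D^2\varphi(x))\le 0$. Write $F[u]=F(x,u,\nabla u,D^2u)$. $F$ satisfies the weak minimum principle in $\Omega$ if: $F[u]\le 0$ in $\Omega$ and $\liminf_{x\to\partial\Omega}u\ge 0$ imply $u\ge 0$ in $\Omega$. $F$ satisfies the strong minimum principle in $\Omega$ if: $F[u]\le 0$ in $\Omega$ and $u\ge 0$ in $\Omega$ imply that either $u>0$ in $\Omega$ or $u\equiv 0$ in $\Omega$. *)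

(* Defs.v *)
From mathcomp Require Import all_boot all_order all_algebra.
From mathcomp Require Import all_classical all_reals all_analysis.
From mathcomp Require complex.

Set Implicit Arguments.
Unset Strict Implicit.
Unset Printing Implicit Defensive.

Import Order.TTheory GRing.Theory Num.Theory.
Import numFieldNormedType.Exports.

Local Open Scope classical_set_scope.
Local Open Scope ring_scope.

Section Euclidean.
Context {R : realType} {N : nat}.
Implicit Types (x : 'rV[R]_N) (Omega : set 'rV[R]_N).

(* The library norm of 'rV[R]_N is the sup norm: it induces the same topology
   and the same bounded sets, but not the same balls. *)
Definition enorm x : R := Num.sqrt (\sum_i x 0 i ^+ 2).

Definition eball0 (r : R) : set 'rV[R]_N := [set x | enorm x < r].

Definition domain Omega := [/\ open Omega, connected Omega & Omega !=set0].

Definition boundary Omega := closure Omega `\` interior Omega.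

(* The filter base of the limits x --> boundary Omega, x in Omega:
   the sets {x in Omega | dist(x, boundary Omega) < d} for d > 0. *)
Definition to_boundary Omega : set_system 'rV[R]_N :=
  filter_from [set d : R | 0 < d] (fun d => [set x | Omega x /\
    exists2 z, boundary Omega z & enorm (x - z) < d]).

End Euclidean.

Section OrderedEigenvalues.
Context {R : realType} {N : nat}.
Implicit Types X : 'M[R]_N.

Definition is_eigenvalues X (s : seq R) :=
  sorted <=%R s /\ char_poly X = \prod_(a <- s) ('X - a%:P).

(* The nondecreasing sequence of the eigenvalues, with multiplicity; it is empty
   when the characteristic polynomial does not split over R, which does not
   happen for symmetric X (eigenvaluesP below). *)
Definition eigenvalues X : seq R := xget [::] (is_eigenvalues X).

(* Indices start from 0: lambda X i is the (i+1)-th smallest eigenvalue. *)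
Definition lambda X (i : nat) : R := (eigenvalues X)`_i.

Definition Pminus (k : nat) X : R := \sum_(i < k) lambda X i.

Lemma is_eigenvalues_size X s : is_eigenvalues X s -> size s = N.
Proof.
case=> _ /(congr1 (fun p : {poly R} => size p)).
by rewrite size_char_poly size_prod_XsubC => -[].
Qed.

Lemma is_eigenvalues_uniq X s t :
  is_eigenvalues X s -> is_eigenvalues X t -> s = t.
Proof.
move=> [ss es] [st et]; apply: (le_sorted_eq ss st).
by apply: prod_XsubC_eq; rewrite -es -et.
Qed.

End OrderedEigenvalues.

Section Spectral.
Context {R : realType} {N : nat}.
Implicit Types X : 'M[R]_N.
Import complex.

Lemma char_poly_conj (F : fieldType) (P D : 'M[F]_N) : P \in unitmx ->
  char_poly (invmx P *m D *m P) = char_poly D.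
Proof.
move=> Pu; rewrite /char_poly.
have -> : char_poly_mx (invmx P *m D *m P) =
    map_mx polyC (invmx P) *m char_poly_mx D *m map_mx polyC P.
  rewrite /char_poly_mx mulmxBr mulmxBl -!map_mxM /=; congr (_ - _).
  by rewrite mul_mx_scalar -scalemxAl -map_mxM mulVmx // map_mx1 scalemx1.
rewrite !det_mulmx mulrC mulrA -det_mulmx -map_mxM mulmxV //.
by rewrite map_mx1 det1 mul1r.
Qed.

Lemma eigenvaluesP X : X^T = X -> is_eigenvalues X (eigenvalues X).
Proof.
move=> symX; suff [s Xs] : exists s, is_eigenvalues X s.
  exact: (@xgetPex _ [::] (is_eigenvalues X) (ex_intro _ s Xs)).
pose f := real_complex R; pose A := map_mx f X.
have Areal : A \is a mxOver Num.real.
  by apply/mxOverP => i j; rewrite mxE complex_real.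
have Asym : A \is symmetricmx.
  by apply/is_hermitianmxP; rewrite expr0 scale1r map_mx_id // /A map_trmx symX.
have Aherm := realsym_hermsym Asym Areal.
have /orthomx_spectralP eA := hermitian_normalmx Aherm.
have /mxOverP Dreal := hermitian_spectral_diag_real Aherm.
have chA : char_poly A = \prod_(i < N) ('X - (spectral_diag A 0 i)%:P).
  rewrite [in LHS]eA char_poly_conj ?spectral_unit //.
  rewrite char_poly_trig ?diag_mx_is_trig //.
  by apply: eq_bigr => i _; rewrite mxE eqxx mulr1n.
pose s := sort <=%R [seq complex.Re (spectral_diag A 0 i) | i <- enum 'I_N].
exists s; split; first exact: (sort_sorted le_total).
apply: (map_poly_inj f); rewrite map_char_poly [LHS]chA.
rewrite rmorph_prod /= (perm_big _ (permEl (perm_sort _ _))) big_map big_enum /=.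
apply: eq_bigr => i _; rewrite map_polyXsubC; congr ('X - _%:P).
by rewrite /f /= RRe_real.
Qed.

End Spectral.

Section Calculus.
Context {R : realType} {N : nat}.
Implicit Types (phi : 'rV[R]_N -> R) (x : 'rV[R]_N).

Definition partial (i : 'I_N) phi : 'rV[R]_N -> R :=
  fun x => 'D_(delta_mx 0 i) phi x.

Definition gradient phi x : 'rV[R]_N := \row_i partial i phi x.

Definition hessian phi x : 'M[R]_N := \matrix_(i, j) partial i (partial j phi) x.

Definition C2_near phi x := \forall y \near x,
  [/\ {for y, continuous phi},
      forall i, derivable phi y (delta_mx 0 i) /\
                {for y, continuous (partial i phi)}
    & forall i j, derivable (partial j phi) y (delta_mx 0 i) /\
                  {for y, continuous (partial i (partial j phi))}].

End Calculus.

Section Viscosity.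
Context {R : realType} {N : nat}.

(* Second-order operators (x, u, p, X) |-> F(x, u, p, X). *)
Definition operator := 'rV[R]_N -> R -> 'rV[R]_N -> 'M[R]_N -> R.

Implicit Types (F : operator) (Omega : set 'rV[R]_N) (u : 'rV[R]_N -> R).

Definition touches_below phi u (x : 'rV[R]_N) : Prop :=
  phi x = u x /\ \forall y \near x, phi y <= u y.

(* Functions are total, but only the values of u in the open set Omega matter:
   lower semicontinuity is that of the restriction of u to Omega. *)
Definition supersolution F Omega u :=
  lower_semicontinuous (EFin \o u : subspace Omega -> \bar R) /\
  forall x, Omega x -> forall phi : 'rV[R]_N -> R,
    C2_near phi x -> touches_below phi u x ->
    F x (u x) (gradient phi x) (hessian phi x) <= 0.

Definition weak_minimum_principle F Omega := forall u,
  supersolution F Omega u ->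
  (0 <= limf_einf (EFin \o u) (to_boundary Omega))%E ->
  forall x, Omega x -> 0 <= u x.

Definition strong_minimum_principle F Omega := forall u,
  supersolution F Omega u ->
  (forall x, Omega x -> 0 <= u x) ->
  (forall x, Omega x -> 0 < u x) \/ (forall x, Omega x -> u x = 0).

Definition Pminus_plus (k : nat) (H : 'rV[R]_N -> 'rV[R]_N -> R) : operator :=
  fun x _ p X => Pminus k X + H x p.

End Viscosity.
Arguments operator : clear implicits.

(* Main.v *)
Require Import Defs.
From mathcomp Require Import all_boot all_order all_algebra.
From mathcomp Require Import all_classical all_reals all_analysis.
From mathcomp Require complex.
From mathcomp Require Import ring lra.
Import Order.TTheory GRing.Theory Num.Theory.
Import numFieldNormedType.Exports.
Local Open Scope classical_set_scope.
Local Open Scope ring_scope.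

(** The two counterexamples are radial, and one remark covers both.  Suppose
    that a C^2 function phi touches u = g(|x - x0|^2) from below at x, and put
    g' = g'(|x - x0|^2).  Then the gradient of phi at x is 2 g' (x - x0); along
    a line leaving x in a unit direction v orthogonal to x - x0, phi lies below
    t |-> g(|x - x0|^2 + t^2), so D^2 phi (v, v) <= 2 g'.  The quadratic form of
    D^2 phi is thus at most 2 g' on a hyperplane, hence all the eigenvalues of
    D^2 phi but the largest are at most 2 g' (lambda_le_hyperplane).  As k < N,
    P_k^-(D^2 phi) <= 2 k g' (radial_touch_Pminus), and u is a supersolution of
    P_k^-(D^2 u) + h |Du| as soon as k g' + h |g'| |x - x0| <= 0
    (radial_supersolution_at).

    (a) With h = b this holds where g' = 0, and where g' < 0 and
    b |x - x0| <= k.  So u = max(0, rho^2 - |x - x0|^2)^2 with b rho <= k is a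
    supersolution, which is positive near x0 and vanishes off a small ball:
    the strong minimum principle fails (strong_minimum_principle_fails).

    (c) With h = - b it holds where g' <= 0, and where b |x - x0| >= k.  The
    radial well u = (|x|^2 - m)^2 - (r^2 - m)^2 with m = (k / b)^2 < r^2
    decreases in |x| up to |x| = k / b and increases from there on; it is
    therefore a supersolution in the ball of radius r.  It vanishes on the
    sphere and is negative inside (weak_minimum_principle_fails).

    (b) If u takes a negative value, then for a small alpha > 0 the function
    u - alpha |x|^2 still has an interior minimum p, so that a translate of
    alpha |x|^2 touches u from below at p.  But
    P_k^-(2 alpha I) - b |2 alpha p| = 2 alpha (k - b |p|) is positive, because
    |p| < r and b r <= k (weak_minimum_principle_holds).

    Test functions are only known to have continuous partial derivatives of
    order at most 2 near the contact point.  Directional derivatives are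
    recovered from the partial ones by is_derive_partials, and the symmetry of
    the Hessian, without which the spectral theorem does not apply, is
    Schwarz's theorem (hessian_sym).  The eigenvalue bound is deduced from the
    spectral theorem for complex Hermitian matrices by splitting complex
    vectors into their real and imaginary parts (Re_hermitian_form). *)

(** * Derivatives along lines *)

Lemma is_derive_line {R : realType} {N : nat} (f : 'rV[R]_N -> R)
    (y v : 'rV[R]_N) (t d : R) :
  is_derive (y + t *: v) v f d -> is_derive t 1 (fun s => f (y + s *: v)) d.
Proof.
have E : (fun h : R => h^-1 *: ((f \o shift (y + t *: v)) (h *: v) -
      f (y + t *: v))) =
    (fun h : R => h^-1 *: (((fun s => f (y + s *: v)) \o shift t) (h *: 1) -
      f (y + t *: v))).
  apply/funext => h /=; congr (_ *: (f _ - _)).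
  by rewrite [h *: 1]mulr1 scalerDl addrCA.
case=> df vf; split.
  by move: df; rewrite /derivable E.
by move: vf; rewrite /derive E.
Qed.

(** The step [h] may have either sign, because the coordinates by which it is
    multiplied below do. *)
Lemma MVT_line {R : realType} {N : nat} (f : 'rV[R]_N -> R)
    (y v : 'rV[R]_N) (h : R) :
  (forall t : R, `|t| <= `|h| -> derivable f (y + t *: v) v) ->
  exists2 t : R, `|t| <= `|h| & f (y + h *: v) - f y = h * 'D_v f (y + t *: v).
Proof.
move=> df; pose g s := f (y + s *: v).
have dg (t : R) : `|t| <= `|h| -> is_derive (t : R) (1 : R) g ('D_v f (y + t *: v)).
  by move=> /df dt; apply: is_derive_line; exact: derivableP.
have cg (A : set R) : (forall t, A t -> `|t| <= `|h|) ->
    {within A, continuous g}.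
  move=> Ah; apply: continuous_in_subspaceT => t /set_mem /Ah /dg dt.
  by apply: differentiable_continuous; apply/derivable1_diffP; exact: ex_derive.
case: (lerP 0 h) => h0.
  have inh t : t \in `[0, h]%R -> `|t| <= `|h|.
    by rewrite in_itv/= => /andP[t0 th]; rewrite !ger0_norm.
  have [|||t /inh th E] := @MVT_segment R g (fun t => 'D_v f (y + t *: v)) 0 h.
  - by [].
  - by move=> t /subset_itv_oo_cc /inh /dg.
  - by apply: cg => t /inh.
  exists t => //; move: E; rewrite /g scale0r addr0 subr0 => ->.
  by rewrite mulrC.
have inh t : t \in `[h, 0]%R -> `|t| <= `|h|.
  by rewrite in_itv/= => /andP[t0 th]; rewrite !ler0_norm ?lerN2// ltW.
have [|||t /inh th E] := @MVT_segment R g (fun t => 'D_v f (y + t *: v)) h 0.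
- exact: ltW.
- by move=> t /subset_itv_oo_cc /inh /dg.
- by apply: cg => t /inh.
exists t => //; move: E; rewrite /g scale0r addr0 sub0r => E.
by rewrite -opprB E mulrN opprK mulrC.
Qed.

Lemma near_entrywise {R : realType} {N : nat} (y : 'rV[R]_N)
    (P : 'rV[R]_N -> Prop) :
  (\forall z \near y, P z) ->
  exists2 d : R, 0 < d & forall v : 'rV[R]_N, (forall i, `|v 0 i| < d) -> P (y + v).
Proof.
move=> /nbhs_ballP[d /= d0 dP]; exists d => // v vd; apply: dP; split=> // i j.
by rewrite /ball/= ord1 mxE opprD addrA subrr sub0r normrN.
Qed.

(** Continuous partial derivatives give directional derivatives: going from [y]
    to [y + h *: v] one coordinate at a time, the mean value theorem expresses
    each increment with a partial derivative at a point close to [y]. *)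
Lemma is_derive_partials {R : realType} {N : nat} (f : 'rV[R]_N -> R)
    (y v : 'rV[R]_N) :
  (\forall z \near y, forall i, derivable f z (delta_mx 0 i)) ->
  (forall i, {for y, continuous (partial i f)}) ->
  is_derive y v f (\sum_i v 0 i * partial i f y).
Proof.
move=> df cf; set D := \sum_i _.
pose q (h : R) := h^-1 *: ((f \o shift y) (h *: v) - f y).
suff qD : q h @[h --> 0^'] --> D.
  by split; [apply/cvg_ex; exists D | apply: (@cvg_lim R^o)].
pose V : R := \sum_i `|v 0 i|.
have V0 : 0 <= V by apply: sumr_ge0 => i _; exact: normr_ge0.
have vV i : `|v 0 i| <= V.
  by rewrite /V (bigD1 i)//= lerDl; apply: sumr_ge0 => j _; exact: normr_ge0.
apply/(@cvgrPdist_le R R^o) => eps eps0.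
have V1 : 0 < V + 1 by apply: ltr_wpDl.
have : \forall z \near y, forall i, derivable f z (delta_mx 0 i) /\
    `|partial i f y - partial i f z| <= eps / (V + 1).
  have cf' i : \forall z \near y,
      `|partial i f y - partial i f z| <= eps / (V + 1).
    by move: (cf i) => /cvgrPdist_le; apply; exact: divr_gt0.
  have cfz := filter_forall (nbhs_filter y) cf'.
  by apply: filterS2 df cfz => z dz cz i; split.
move=> /near_entrywise[d d0 dP].
near=> h.
have h0 : h != 0 by near: h; exact: nbhs_dnbhs_neq.
(* Each point used below is at most [2 * |h| * V] away from [y], entry by entry;
   the 1 keeps the bound positive when [v] is zero. *)
have hV : `|h| * (2 * (V + 1)) < d.
  rewrite -ltr_pdivlMr ?mulr_gt0//; near: h; apply: dnbhs0_lt.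
  by rewrite divr_gt0 ?mulr_gt0.
(* [w k] keeps the first [k] coordinates of [v]: the path from [y] to
   [y + h *: v] visits the points [y + h *: w k]. *)
pose w (k : nat) : 'rV[R]_N := \row_i (if (i < k)%N then v 0 i else 0).
have wS (j : 'I_N) : w j.+1 = w j + v 0 j *: delta_mx 0 j.
  apply/rowP => i; rewrite !mxE eqxx/= ltnS leq_eqVlt.
  have [->|ij] := eqVneq i j; first by rewrite eqxx ltnn mulr1 add0r.
  by rewrite (inj_eq val_inj) (negPf ij) mulr0 addr0.
have w0 : w 0%N = 0 by apply/rowP => i; rewrite !mxE ltn0.
have wN : w N = v by apply/rowP => i; rewrite !mxE ltn_ord.
have step (j : 'I_N) : exists z, `|partial j f y - partial j f z| <= eps / (V + 1) /\
    f (y + h *: w j.+1) - f (y + h *: w j) = h * v 0 j * partial j f z.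
  have small (t : R) : `|t| <= `|h * v 0 j| ->
      forall i, `|(h *: w j + t *: delta_mx 0 j) 0 i| < d.
    move=> th i; apply: le_lt_trans hV; rewrite !mxE.
    apply: le_trans (ler_normD _ _) _; rewrite !normrM.
    have -> : `|h| * (2 * (V + 1)) = `|h| * (V + 1) + `|h| * (V + 1) by ring.
    apply: lerD.
      apply: ler_wpM2l => //; case: ifP => _; last by rewrite normr0 ltW.
      by rewrite (le_trans (vV i))// lerDl.
    apply: le_trans (_ : `|h * v 0 j| * 1 <= _).
      by apply: ler_pM => //; case: (_ && _); rewrite ?normr1 ?normr0.
    rewrite mulr1 normrM; apply: ler_wpM2l => //.
    by rewrite (le_trans (vV j))// lerDl.
  have [|t th E] := @MVT_line R N f (y + h *: w j) (delta_mx 0 j) (h * v 0 j).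
    by move=> t /small /dP/(_ j)[+ _]; rewrite addrA.
  exists (y + h *: w j + t *: delta_mx 0 j); split.
    by have [_] := dP _ (small _ th) j; rewrite addrA.
  by rewrite wS scalerDr scalerA addrA.
have /choice[z zP] := step.
have -> : D - q h = \sum_j v 0 j * (partial j f y - partial j f (z j)).
  under [RHS]eq_bigr do rewrite mulrBr.
  rewrite sumrB; congr (_ - _); rewrite /q /= [h *: v + y]addrC.
  have -> : f (y + h *: v) - f y =
      \sum_(0 <= k < N) (f (y + h *: w k.+1) - f (y + h *: w k)).
    by rewrite (telescope_sumr (fun k => f (y + h *: w k)))// wN w0 scaler0 addr0.
  rewrite big_mkord (eq_bigr (fun j => h * (v 0 j * partial j f (z j)))).
    by rewrite -mulr_sumr /GRing.scale/= mulKf.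
  by move=> j _; have [_ ->] := zP j; rewrite mulrA.
apply: le_trans (ler_norm_sum _ _ _) _.
apply: (@le_trans _ _ (\sum_j `|v 0 j| * (eps / (V + 1)))).
  by apply: ler_sum => j _; rewrite normrM ler_wpM2l//; have [] := zP j.
rewrite -mulr_suml -/V mulrA ler_pdivrMr// mulrC; apply: ler_wpM2l; first exact: ltW.
by rewrite lerDl.
Unshelve. all: by end_near.
Qed.

(** * Symmetry of the Hessian *)

Lemma is_derive_translate {R : realType} {N : nat} (f : 'rV[R]_N -> R)
    (z w v : 'rV[R]_N) (d : R) :
  is_derive (z + w) v f d -> is_derive z v (fun y => f (y + w)) d.
Proof.
have E : (fun h : R => h^-1 *: ((f \o shift (z + w)) (h *: v) - f (z + w))) =
    (fun h : R => h^-1 *: (((fun y => f (y + w)) \o shift z) (h *: v) -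
      f (z + w))).
  by apply/funext => h /=; rewrite addrA.
case=> df vf; split.
  by move: df; rewrite /derivable E.
by move: vf; rewrite /derive E.
Qed.

(** The second difference of [f] over a square with sides along two coordinate
    directions is a mixed derivative at some point, by the mean value theorem
    along [i], then along [j]; this order makes [partial j] the outer
    derivative. *)
Lemma mixed_difference {R : realType} {N : nat} (f : 'rV[R]_N -> R)
    (x : 'rV[R]_N) (i j : 'I_N) (h : R) :
  let z (s t : R) := x + s *: delta_mx 0 i + t *: delta_mx 0 j in
  (forall s t, `|s| <= `|h| -> `|t| <= `|h| ->
     derivable f (z s t) (delta_mx 0 i) /\
     derivable (partial i f) (z s t) (delta_mx 0 j)) ->
  exists s t, [/\ `|s| <= `|h|, `|t| <= `|h| &
    f (z h h) - f (z 0 h) - (f (z h 0) - f (z 0 0)) =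
      h * (h * partial j (partial i f) (z s t))].
Proof.
move=> z dz.
pose g y := f (y + h *: delta_mx 0 j) - f y.
have dg s : `|s| <= `|h| -> is_derive (x + s *: delta_mx 0 i) (delta_mx 0 i) g
    (partial i f (z s h) - partial i f (z s 0)).
  move=> sh; apply: is_deriveB.
    by apply/is_derive_translate/derivableP; have [] := dz s h sh (lexx _).
  have [|df _] := dz s 0 sh; first by rewrite normr0.
  by move: df; rewrite /z scale0r addr0 => /derivableP.
have [s sh Es] : exists2 s : R, `|s| <= `|h| &
    g (x + h *: delta_mx 0 i) - g x = h * 'D_(delta_mx 0 i) g (x + s *: delta_mx 0 i).
  by apply: MVT_line => t /dg[].
have [t th Et] : exists2 t : R, `|t| <= `|h| & partial i f (z s 0 + h *: delta_mx 0 j) -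
    partial i f (z s 0) = h * partial j (partial i f) (z s 0 + t *: delta_mx 0 j).
  apply: MVT_line => t th; have [_] := dz s t sh th.
  by rewrite /z scale0r addr0.
have zE u : z s u = z s 0 + u *: delta_mx 0 j by rewrite /z scale0r addr0.
exists s, t; split => //.
rewrite zE -Et -zE; have [_ <-] := dg s sh; rewrite -Es /g /z.
by rewrite !scale0r !addr0; ring.
Qed.

(** Schwarz's theorem.  The second difference is symmetric in the two
    directions, so both mixed derivatives take a common value arbitrarily close
    to [x] (at different points), and they are continuous at [x]. *)
Lemma hessian_sym {R : realType} {N : nat} (phi : 'rV[R]_N -> R)
    (x : 'rV[R]_N) :
  C2_near phi x -> (hessian phi x)^T = hessian phi x.
Proof.
move=> C2; apply/matrixP => i j; rewrite !mxE.
have cont (k l : 'I_N) : {for x, continuous (partial k (partial l phi))}.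
  by have [_ _ /(_ k l)[_]] := nbhs_singleton C2.
apply/eqP; rewrite eq_sym -subr_eq0 -normr_le0; apply/ler_addgt0Pl => e e0.
have e2 : 0 < e / 2 by lra.
rewrite addr0.
have near_cont k l : \forall z \near x,
    `|partial k (partial l phi) x - partial k (partial l phi) z| <= e / 2.
  by move: (cont k l) => /cvgrPdist_le; apply.
have [d d0 dP] := near_entrywise _ _
  (filterI C2 (filterI (near_cont i j) (near_cont j i))).
(* A point of the square of side [h] moves each entry by at most [2 * h < d]. *)
pose h := d / 3.
have h0 : 0 < h by rewrite /h; lra.
have box k l (s t : R) : `|s| <= `|h| -> `|t| <= `|h| ->
    forall m, `|(s *: delta_mx 0 k + t *: delta_mx 0 l : 'rV[R]_N) 0 m| < d.
  move=> sh th m; rewrite !mxE; apply: le_lt_trans (ler_normD _ _) _.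
  have db (b c : bool) (r : R) : `|r| <= `|h| -> `|r * (b && c)%:R| <= h.
    rewrite (gtr0_norm h0) => rh; rewrite normrM -[leRHS]mulr1.
    by apply: ler_pM => //; case: (b && c); rewrite ?normr1 ?normr0.
  apply: le_lt_trans (lerD (db _ _ s sh) (db _ _ t th)) _.
  by move: d0; rewrite /h; lra.
have der k l (s t : R) : `|s| <= `|h| -> `|t| <= `|h| ->
    let z := x + s *: delta_mx 0 k + t *: delta_mx 0 l in
    derivable phi z (delta_mx 0 k) /\
    derivable (partial k phi) z (delta_mx 0 l).
  move=> sh th /=; rewrite -addrA.
  by have [[_ /(_ k)[? _] /(_ l k)[? _]] _] := dP _ (box k l s t sh th).
have [s [t [sh th Est]]] := mixed_difference phi x i j h (der i j).
have [t' [s' [th' sh' Ets]]] := mixed_difference phi x j i h (der j i).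
have [_ [_ near_ji]] := dP _ (box i j s t sh th).
have [_ [near_ij _]] := dP _ (box j i t' s' th' sh').
have E : partial j (partial i phi) (x + s *: delta_mx 0 i + t *: delta_mx 0 j) =
    partial i (partial j phi) (x + t' *: delta_mx 0 j + s' *: delta_mx 0 i).
  apply: (mulfI (lt0r_neq0 h0)); apply: (mulfI (lt0r_neq0 h0)).
  apply: etrans (esym Est) (etrans _ Ets).
  have subrACA (p q r u : R) : p - q - (r - u) = p - r - (q - u) by ring.
  by rewrite !scale0r !addr0 (addrAC x (h *: delta_mx 0 j)); exact: subrACA.
move: near_ij near_ji; rewrite !addrA E => near_ij near_ji.
rewrite [e](splitr e).
apply: le_trans (ler_distD _ _ _) (lerD near_ij _).
by rewrite distrC.
Qed.

(** * Second derivative at a maximum *)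

(** If [b] were positive, [f1] would be positive on the right of 0, and [f]
    would exceed [f 0] there. *)
Lemma second_derivative_max {R : realType} (f f1 : R -> R) (b : R) :
  (\forall t \near (0 : R), is_derive t (1 : R) f (f1 t)) -> is_derive (0 : R) (1 : R) f1 b ->
  (\forall t \near (0 : R), f t <= f 0) -> f1 0 = 0 /\ b <= 0.
Proof.
move=> df df1 fmax.
have f10 : f1 0 = 0.
  have [d /= d0 dP] := filterI df fmax.
  have ball0 t : t \in `]-d, d[%R -> ball (0 : R) d t.
    by rewrite in_itv/= -ltr_norml /ball/= sub0r normrN.
  have dd : -d <= d by rewrite (le_trans (_ : _ <= 0)) ?oppr_le0// ltW.
  have in0 : 0 \in `]-d, d[%R by rewrite in_itv/= oppr_lt0 d0.
  have der0 : is_derive (0 : R) (1 : R) f 0.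
    apply: (derive1_at_max dd) => [t /ball0/dP[[]]//|//|t /ball0/dP[]//].
  by have [[_ <-] _] := dP _ (ball0 _ in0); have [] := der0.
split => //; rewrite leNgt; apply/negP => b0.
have : (h^-1 *: ((f1 \o shift 0) (h *: 1) - f1 0)) @[h --> 0^'] --> b.
  by have [+ <-] := df1; exact.
move=> /(@cvgrPdist_lt R R^o)/(_ b b0) f1b.
have [d /= d0 dP] : \forall h \near (0 : R)^', [/\ is_derive h (1 : R) f (f1 h), f h <= f 0 &
    0 < h -> 0 < f1 h].
  have df' := nbhs_dnbhs df; have fmax' := nbhs_dnbhs fmax.
  apply: filterS3 df' fmax' f1b => h dfh fh f1bh; split => // h0.
  move: f1bh; rewrite /= f10 subr0 addr0 [h *: 1]mulr1 ltr_distlC subrr.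
  by case/andP=> + _; rewrite /GRing.scale/= pmulr_rgt0// invr_gt0.
have in_d t : 0 < t -> t < d -> [/\ is_derive t (1 : R) f (f1 t), f t <= f 0 & 0 < f1 t].
  move=> t0 td; have [||dft ft /(_ t0) f1t] // := dP t.
    by rewrite /= sub0r normrN gtr0_norm.
  by rewrite gt_eqF.
have d2 : 0 < d / 2 by lra.
have d2d : d / 2 < d by lra.
have [||c] := @MVT R f f1 0 (d / 2) d2.
- by move=> t; rewrite in_itv/= => /andP[t0 td]; have [] := in_d t t0 (lt_trans td d2d).
- apply: continuous_in_subspaceT => t /set_mem/=; rewrite in_itv/= => /andP[t0 td].
  apply: differentiable_continuous; apply/derivable1_diffP.
  move: t0; rewrite le_eqVlt => /predU1P[<-|t0].
    by have [] := nbhs_singleton df.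
  by have [[]] := in_d t t0 (le_lt_trans td d2d).
rewrite in_itv/= => /andP[c0 cd] E.
have [_ _ f1c] := in_d c c0 (lt_trans cd d2d).
have [_ + _] := in_d _ d2 d2d.
by rewrite -subr_le0 E subr0 leNgt mulr_gt0.
Qed.

(** * Scalar product *)

Definition dot {R : pzRingType} {N : nat} (x y : 'rV[R]_N) : R :=
  \sum_i x 0 i * y 0 i.

Lemma dotE {R : pzRingType} {N : nat} (x y : 'rV[R]_N) :
  dot x y = (x *m y^T) 0 0.
Proof. by rewrite mxE; apply: eq_bigr => i _; rewrite mxE. Qed.

Lemma dotC {R : comPzRingType} {N : nat} (x y : 'rV[R]_N) : dot x y = dot y x.
Proof. by apply: eq_bigr => i _; rewrite mulrC. Qed.

Lemma dotDl {R : pzRingType} {N : nat} (x y z : 'rV[R]_N) :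
  dot (x + y) z = dot x z + dot y z.
Proof. by rewrite !dotE mulmxDl mxE. Qed.

Lemma dotZl {R : pzRingType} {N : nat} (a : R) (x z : 'rV[R]_N) :
  dot (a *: x) z = a * dot x z.
Proof. by rewrite !dotE -scalemxAl mxE. Qed.

Lemma dotZr {R : comPzRingType} {N : nat} (a : R) (x z : 'rV[R]_N) :
  dot x (a *: z) = a * dot x z.
Proof. by rewrite dotC dotZl dotC. Qed.

Lemma dot_line {R : comPzRingType} {N : nat} (z v : 'rV[R]_N) (t : R) :
  dot (z + t *: v) (z + t *: v) = dot z z + (2 * t * dot z v + t ^+ 2 * dot v v).
Proof.
rewrite dotDl dotC dotDl dotZl dotZl (dotC v (_ + _)) dotDl dotZl (dotC v z).
ring.
Qed.

Lemma dot_delta {R : pzRingType} {N : nat} (x : 'rV[R]_N) (i : 'I_N) :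
  dot x (delta_mx 0 i) = x 0 i.
Proof.
rewrite /dot (bigD1 i)//= mxE !eqxx mulr1 big1 ?addr0// => j ji.
by rewrite mxE (negPf ji) andbF mulr0.
Qed.

(** * Contact from below with a radial function *)

Lemma near_line {R : realType} {N : nat} (x v : 'rV[R]_N)
    (P : 'rV[R]_N -> Prop) :
  (\forall y \near x, P y) -> \forall t \near (0 : R), P (x + t *: v).
Proof.
suff line0 : x + t *: v @[t --> (0 : R)] --> x by exact: line0.
have {2}-> : x = x + 0 *: v by rewrite scale0r addr0.
by apply: cvgD; [exact: cvg_cst | apply: cvgZr_tmp; exact: cvg_id].
Qed.

(** The chain rule for a C^2 function along a line, in the form consumed by
    [second_derivative_max]. *)
Lemma C2_line {R : realType} {N : nat} (phi : 'rV[R]_N -> R)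
    (x v : 'rV[R]_N) :
  C2_near phi x ->
  (\forall t \near (0 : R), is_derive (t : R) (1 : R) (fun s => phi (x + s *: v))
     (dot v (gradient phi (x + t *: v)))) /\
  is_derive (0 : R) (1 : R) (fun t => dot v (gradient phi (x + t *: v)))
    (dot (v *m hessian phi x) v).
Proof.
move=> C2; split.
  apply: filterS (near_line _ v _ (nbhs_interior C2)) => t C2y.
  apply: is_derive_line; rewrite (_ : dot _ _ = \sum_i v 0 i * partial i phi (x + t *: v)).
    apply: is_derive_partials => [|i].
      by apply: filterS C2y => z [_ dz _] i; have [] := dz i.
    by have [_ /(_ i)[]] := nbhs_singleton C2y.
  by apply: eq_bigr => i _; rewrite mxE.
have dpartial i : is_derive (0 : R) (1 : R) (fun t => partial i phi (x + t *: v))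
    (\sum_j v 0 j * partial j (partial i phi) x).
  apply: is_derive_line; rewrite scale0r addr0.
  apply: is_derive_partials => [|j].
    by apply: filterS C2 => z [_ _ dz] j; have [] := dz j i.
  by have [_ _ /(_ j i)[]] := nbhs_singleton C2.
have -> : (fun t => dot v (gradient phi (x + t *: v))) =
    \sum_i (v 0 i \*: (fun t : R => partial i phi (x + t *: v))).
  by apply/funext => t; rewrite fct_sumE; apply: eq_bigr => i _; rewrite mxE.
apply: is_derive_eq.
rewrite /dot; apply: eq_bigr => i _; rewrite mulrC mxE; congr (_ * _).
by apply: eq_bigr => j _; rewrite mxE.
Qed.

(** The hypothesis on [phi] compares it with a second-order expansion, in the
    variable |y - x0|^2, of a radial function: on the line [x + t *: v] the
    bound is a polynomial in [t], and [second_derivative_max] applies to the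
    difference.  The term in [C] is the curvature of the profile; only the
    directions orthogonal to [x - x0] do not feel it. *)
Lemma radial_touch {R : realType} {N : nat} (phi : 'rV[R]_N -> R)
    (x0 x : 'rV[R]_N) (a C : R) :
  C2_near phi x ->
  let q y := dot (y - x0) (y - x0) - dot (x - x0) (x - x0) in
  (\forall y \near x, phi y <= phi x + a * q y + C * q y ^+ 2) ->
  gradient phi x = (2 * a) *: (x - x0) /\
  forall v, dot (v *m hessian phi x) v <=
    2 * a * dot v v + 8 * C * dot (x - x0) v ^+ 2.
Proof.
move=> C2 q qmax.
have test v : dot v (gradient phi x) = 2 * a * dot (x - x0) v /\
    dot (v *m hessian phi x) v <= 2 * a * dot v v + 8 * C * dot (x - x0) v ^+ 2.
  have [d1 d2] := C2_line phi x v C2.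
  set b := dot (x - x0) v; set n := dot v v.
  (* [w] is the increment of |y - x0|^2 at y = x + t v. *)
  pose w : {poly R} := (2 * b) *: 'X + n *: 'X^2.
  pose p := a *: w + C *: (w * w).
  have hE := (@hornerD R, @hornerZ R, @hornerM R, @hornerX R, @hornerXn R,
    @hornerMn R, @hornerC R).
  have p0 : (deriv p).[0] = 2 * a * b.
    by rewrite /p /w !poly.derivE !hE; ring.
  have p20 : (deriv (deriv p)).[0] = 2 * a * n + 8 * C * b ^+ 2.
    by rewrite /p /w !poly.derivE !hE; ring.
  have [||] := @second_derivative_max R (fun t => phi (x + t *: v) - p.[t])
    (fun t => dot v (gradient phi (x + t *: v)) - (deriv p).[t])
    (dot (v *m hessian phi x) v - (deriv (deriv p)).[0]).
  - by apply: filterS d1 => t d1t; exact: (is_deriveB d1t (is_derive_poly p t)).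
  - apply: filterS (near_line _ v _ qmax) => t.
    rewrite /q (addrAC x (t *: v)) dot_line -/b -/n.
    rewrite (addrAC (dot _ _)) subrr add0r scale0r addr0 => phit.
    rewrite lerBlDr; apply: le_trans phit _.
    rewrite le_eqVlt; apply/orP; left; apply/eqP.
    by rewrite /p /w !hE; ring.
  by rewrite p0 p20 scale0r addr0 => /subr0_eq -> ; rewrite subr_le0.
split; last by move=> v; have [] := test v.
apply/rowP => i; have [+ _] := test (delta_mx 0 i).
by rewrite dotC !dot_delta => ->; rewrite [in RHS]mxE.
Qed.

(** * Eigenvalues and hyperplanes *)

Section ComplexSpectrum.
Import complex.
Local Open Scope sesquilinear_scope.

(** For a real matrix, complex vectors satisfy the same bounds on the quadratic
    form as their real and imaginary parts. *)
Lemma Re_hermitian_form {R : realType} {N : nat} (B : 'M[R]_N) (y : 'rV[R[i]]_N) :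
  complex.Re ((y *m map_mx (real_complex R) B *m y^t*) 0 0) =
    dot (map_mx (@complex.Re R) y *m B) (map_mx (@complex.Re R) y) +
    dot (map_mx (@complex.Im R) y *m B) (map_mx (@complex.Im R) y).
Proof.
have ReM (z w : R[i]) : complex.Re (z * w^*) =
    complex.Re z * complex.Re w + complex.Im z * complex.Im w.
  by case: z w => [a b] [c d]; rewrite /= mulrN opprK.
rewrite mxE raddf_sum /= /dot -big_split; apply: eq_bigr => j _ /=.
rewrite !mxE ReM; congr (_ * _ + _ * _).
  rewrite raddf_sum /=; apply: eq_bigr => i _; rewrite !mxE.
  by case: (y 0 i) => a b /=; rewrite mulr0 subr0.
rewrite raddf_sum /=; apply: eq_bigr => i _; rewrite !mxE.
by case: (y 0 i) => a b /=; rewrite mulr0 add0r mulrC.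
Qed.

(** Two different positions in the ordered list of eigenvalues correspond to two
    different eigenvectors of a unitary diagonalization, even if the eigenvalues
    coincide: this is where multiplicities are handled. *)
Lemma eigenvalues_spectral {R : realType} {N : nat} (X : 'M[R]_N) (i j : nat) :
  X^T = X -> (i < N)%N -> (j < N)%N -> i != j ->
  exists P : 'M[R[i]]_N, exists d : 'rV[R]_N, exists k l : 'I_N,
    [/\ P *m P^t* = 1%:M,
        map_mx (real_complex R) X = P^t* *m diag_mx (map_mx (real_complex R) d) *m P,
        k != l, lambda X i = d 0 k & lambda X j = d 0 l].
Proof.
move=> symX iN jN ij.
pose f := real_complex R; pose A := map_mx f X.
have Areal : A \is a mxOver Num.real.
  by apply/mxOverP => a b; rewrite mxE complex_real.
have Asym : A \is symmetricmx.
  by apply/is_hermitianmxP; rewrite expr0 scale1r map_mx_id // /A map_trmx symX.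
have Aherm := realsym_hermsym Asym Areal.
have /orthomx_spectralP eA := hermitian_normalmx Aherm.
have /mxOverP Dreal := hermitian_spectral_diag_real Aherm.
pose d : 'rV[R]_N := map_mx (@complex.Re R) (spectral_diag A).
have dE : spectral_diag A = map_mx f d.
  by apply/rowP => a; rewrite !mxE /f /= RRe_real.
have [sorted_s chX] := eigenvaluesP symX.
pose t := [seq d 0 a | a <- enum 'I_N].
have perm_st : perm_eq (eigenvalues X) t.
  apply: prod_XsubC_eq; rewrite -chX; apply: (map_poly_inj f).
  rewrite map_char_poly -/A [in LHS]eA char_poly_conj ?spectral_unit //.
  rewrite char_poly_trig ?diag_mx_is_trig // rmorph_prod big_map big_enum /=.
  by apply: eq_bigr => a _; rewrite map_polyXsubC mxE eqxx mulr1n dE mxE.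
have st : size t = N by rewrite size_map size_enum_ord.
have [Is permI sE] := perm_iotaP 0 perm_st.
have sI : size Is = N by rewrite (perm_size permI) size_iota.
have uI : uniq Is by rewrite (perm_uniq permI) iota_uniq.
have Ilt a : (a < N)%N -> (nth 0%N Is a < N)%N.
  move=> aN; have : nth 0%N Is a \in Is by rewrite mem_nth ?sI.
  by rewrite (perm_mem permI) mem_iota st.
exists (spectralmx A), d, (Ordinal (Ilt _ iN)), (Ordinal (Ilt _ jN)).
have lE a (aN : (a < N)%N) : lambda X a = d 0 (Ordinal (Ilt _ aN)).
  rewrite /lambda sE (nth_map 0%N) ?sI // (nth_map (Ordinal aN)) ?size_enum_ord ?Ilt //.
  by congr (d 0 _); apply: val_inj; rewrite /= nth_enum_ord ?Ilt.
split; rewrite -?lE //.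
- exact/unitarymxP/spectral_unitarymx.
- by rewrite -invmx_unitary ?spectral_unitarymx // -dE.
- by rewrite -val_eqE /= nth_uniq ?sI.
Qed.

(** A case of the Courant-Fischer principle: if the second largest eigenvalue
    exceeded [c], the form would exceed [c] on a plane, and this plane meets
    the hyperplane orthogonal to [z]. *)
Lemma lambda_le_hyperplane {R : realType} {N : nat} (X : 'M[R]_N)
    (z : 'rV[R]_N) (c : R) (i : nat) :
  X^T = X -> (forall v, dot z v = 0 -> dot (v *m X) v <= c * dot v v) ->
  (i.+1 < N)%N -> lambda X i <= c.
Proof.
move=> symX Xle iN; rewrite leNgt; apply/negP => ci.
have [|P [d [k [l [PP XE kl dk dl]]]]] :=
    eigenvalues_spectral X i i.+1 symX (ltnW iN) iN.
  by rewrite ltn_eqF.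
have cj : c < lambda X i.+1.
  have [ss _] := eigenvaluesP symX.
  apply: lt_le_trans ci _; apply: (sorted_leq_nth le_trans le_refl 0 ss) => //;
  by rewrite inE (is_eigenvalues_size (eigenvaluesP symX)) // ltnW.
pose f := real_complex R.
pose p : 'cV[R[i]]_N := P *m map_mx f z^T.
have [a [b [ab0 ab]]] : exists a b : R[i],
    a * p k 0 + b * p l 0 = 0 /\ (a != 0) || (b != 0).
  have [pk|pk] := eqVneq (p k 0) 0.
    by exists 1, 0; rewrite pk mulr0 mul0r addr0 oner_eq0.
  by exists (p l 0), (- p k 0); rewrite mulNr mulrC subrr oppr_eq0 pk orbT.
(* [y] collects the coordinates, in the basis formed by the rows of [P], of a
   nonzero vector [v] orthogonal to [z] in the plane of the two eigenvectors. *)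
pose y : 'rV[R[i]]_N := a *: delta_mx 0 k + b *: delta_mx 0 l.
have yk : y 0 k = a by rewrite !mxE !eqxx (negPf kl) mulr0 addr0 mulr1.
have yl : y 0 l = b by rewrite !mxE !eqxx eq_sym (negPf kl) mulr0 add0r mulr1.
pose v := y *m P.
have vz : v *m map_mx f z^T = 0.
  apply/matrixP => u w; rewrite [RHS]mxE /v -mulmxA -/p mulmxDl.
  by rewrite -!scalemxAl -!rowE !ord1 mxE mxE [X in _ + X]mxE ![row _ _ _ _]mxE.
(* The real and imaginary parts of [v] are orthogonal to [z] too, as [z] is real. *)
have Re_le : complex.Re ((v *m map_mx f (X - c%:M) *m v^t*) 0 0) <= 0.
  have vz' (g : {additive R[i] -> R}) :
    (forall w x, g (w * (x%:C)%C) = g w * x) -> dot z (map_mx g v) = 0.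
    move=> gM; have /matrixP/(_ 0 0) := vz; rewrite !mxE => /(congr1 g).
    rewrite raddf_sum raddf0 => <-; rewrite dotC; apply: eq_bigr => u _.
    by rewrite !mxE gM.
  have XcE w : dot (w *m (X - c%:M)) w = dot (w *m X) w - c * dot w w.
    by rewrite mulmxBr dotDl -scaleN1r dotZl mul_mx_scalar dotZl mulN1r.
  rewrite Re_hermitian_form !XcE; apply: ler_wnDr; rewrite subr_le0; apply/Xle/vz'.
    by move=> [w1 w2] x /=; rewrite mulr0 add0r mulrC.
  by move=> [w1 w2] x /=; rewrite mulr0 subr0.
have Xc : map_mx f (X - c%:M) = P^t* *m diag_mx (map_mx f (d - const_mx c)) *m P.
  have -> : diag_mx (map_mx f (d - const_mx c)) = diag_mx (map_mx f d) - (f c)%:M.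
    by rewrite -diag_const_mx map_mxB map_const_mx linearB.
  rewrite mulmxBr mulmxBl -XE map_mxB map_scalar_mx mul_mx_scalar.
  by rewrite -scalemxAl (mulmx1C PP) scalemx1.
have vE : (v *m map_mx f (X - c%:M) *m v^t*) 0 0 =
    (`|a| ^+ 2 * (d 0 k - c)%:C + `|b| ^+ 2 * (d 0 l - c)%:C)%C.
  rewrite Xc /v trmx_mul map_mxM /= !mulmxA -(mulmxA y) PP mulmx1.
  rewrite -(mulmxA _ P) PP mulmx1 mxE (bigD1 k)//= (bigD1 l) 1?eq_sym//=.
  rewrite big1 ?addr0 => [|m /andP[mk ml]]; last first.
    by rewrite !mxE (negPf mk) (negPf ml) !andbF !mulr0 addr0 rmorph0 mulr0.
  have diagE m : (y *m diag_mx (map_mx f (d - const_mx c))) 0 m =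
      y 0 m * f (d 0 m - c).
    by rewrite mul_mx_diag !mxE.
  have conjE m : (y^t*) m 0 = (y 0 m)^* by rewrite mxE mxE.
  by rewrite !diagE !conjE yk yl !normCK; congr (_ + _); rewrite mulrAC.
move: Re_le; rewrite leNgt => /negP; apply.
have : (0 : R[i]) < `|a| ^+ 2 * ((d 0 k - c)%:C)%C + `|b| ^+ 2 * ((d 0 l - c)%:C)%C.
  have dk0 : (0 : R[i]) < ((d 0 k - c)%:C)%C by rewrite ltcR subr_gt0 -dk.
  have dl0 : (0 : R[i]) < ((d 0 l - c)%:C)%C by rewrite ltcR subr_gt0 -dl.
  case/orP: ab => [a0|b0].
    by rewrite ltr_pwDl ?mulr_gt0 ?mulr_ge0 ?exprn_gt0 ?exprn_ge0 ?normr_gt0 // ltW.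
  by rewrite ltr_wpDl ?mulr_gt0 ?mulr_ge0 ?exprn_gt0 ?exprn_ge0 ?normr_gt0 // ltW.
by rewrite vE ltcE => /andP[].
Qed.

End ComplexSpectrum.

Lemma Pminus_le_hyperplane {R : realType} {N k : nat} (X : 'M[R]_N)
    (z : 'rV[R]_N) (c : R) :
  X^T = X -> (forall v, dot z v = 0 -> dot (v *m X) v <= c * dot v v) ->
  (k < N)%N -> Pminus k X <= k%:R * c.
Proof.
move=> symX Xle kN.
have -> : k%:R * c = \sum_(i < k) c by rewrite sumr_const card_ord mulr_natl.
apply: ler_sum => i _; apply: (lambda_le_hyperplane X z) => //.
exact: leq_ltn_trans (ltn_ord i) kN.
Qed.

Lemma Pminus_scalar {R : realType} {N k : nat} (c : R) :
  (k <= N)%N -> Pminus k (c%:M : 'M[R]_N) = k%:R * c.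
Proof.
move=> kN; have Ec : is_eigenvalues (c%:M : 'M[R]_N) (nseq N c).
  split; last first.
    rewrite char_poly_trig ?scalar_mx_is_trig // big_nseq iter_mulr_1.
    rewrite (eq_bigr (fun=> 'X - c%:P)) ?prodr_const ?card_ord // => i _.
    by rewrite mxE eqxx mulr1n.
  by apply/(sortedP 0) => i; rewrite size_nseq => iN; rewrite !nth_nseq iN ltnW.
have E : eigenvalues (c%:M : 'M[R]_N) = nseq N c.
  apply: is_eigenvalues_uniq Ec; apply: eigenvaluesP; exact: tr_scalar_mx.
rewrite /Pminus (eq_bigr (fun => c)) ?sumr_const ?card_ord ?mulr_natl // => i _.
by rewrite /lambda E nth_nseq (leq_trans (ltn_ord i)).
Qed.

(** For [k < N], P_k^- does not involve the largest eigenvalue, the only one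
    that the curvature [C] of the profile can raise. *)
Lemma radial_touch_Pminus {R : realType} {N k : nat} (phi : 'rV[R]_N -> R)
    (x0 x : 'rV[R]_N) (a C : R) :
  (k < N)%N -> C2_near phi x ->
  let q y := dot (y - x0) (y - x0) - dot (x - x0) (x - x0) in
  (\forall y \near x, phi y <= phi x + a * q y + C * q y ^+ 2) ->
  gradient phi x = (2 * a) *: (x - x0) /\
  Pminus k (hessian phi x) <= k%:R * (2 * a).
Proof.
move=> kN C2 q /(radial_touch phi x0 x a C C2)[gE hle]; split => //.
apply: (Pminus_le_hyperplane _ (x - x0)) => //; first exact: hessian_sym.
by move=> v v0; have := hle v; rewrite v0 expr0n mulr0 addr0.
Qed.

(** * Euclidean norm *)

Lemma enormE {R : realType} {N : nat} (x : 'rV[R]_N) :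
  enorm x = Num.sqrt (dot x x).
Proof. by congr Num.sqrt; apply: eq_bigr => i _; rewrite expr2. Qed.

Lemma dot_ge0 {R : realType} {N : nat} (x : 'rV[R]_N) : 0 <= dot x x.
Proof. by apply: sumr_ge0 => i _; rewrite -expr2 sqr_ge0. Qed.

Lemma enorm_ge0 {R : realType} {N : nat} (x : 'rV[R]_N) : 0 <= enorm x.
Proof. exact: sqrtr_ge0. Qed.

Lemma enorm_sqr {R : realType} {N : nat} (x : 'rV[R]_N) :
  enorm x ^+ 2 = dot x x.
Proof. by rewrite enormE sqr_sqrtr ?dot_ge0. Qed.

Lemma enormZ {R : realType} {N : nat} (a : R) (x : 'rV[R]_N) :
  enorm (a *: x) = `|a| * enorm x.
Proof.
rewrite !enormE dotZl dotZr mulrA -expr2 sqrtrM ?sqr_ge0 //.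
by rewrite sqrtr_sqr.
Qed.

Lemma enorm0 {R : realType} {N : nat} : enorm (0 : 'rV[R]_N) = 0.
Proof. by have := enormZ 0 (0 : 'rV[R]_N); rewrite scale0r normr0 mul0r. Qed.

Lemma entry_le_enorm {R : realType} {N : nat} (x : 'rV[R]_N) (i : 'I_N) :
  `|x 0 i| <= enorm x.
Proof.
rewrite -sqrtr_sqr /enorm ler_sqrt; last by apply: sumr_ge0 => j _; rewrite sqr_ge0.
by rewrite (bigD1 i) //= lerDl sumr_ge0 // => j _; rewrite sqr_ge0.
Qed.

Lemma dot_le_enorm {R : realType} {N : nat} (x y : 'rV[R]_N) :
  dot x y <= enorm x * enorm y.
Proof.
have [/eqP y0|y0] := boolP (enorm y == 0).
  rewrite /dot big1 ?y0 ?mulr0 // => i _.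
  have := entry_le_enorm y i; rewrite y0 normr_le0 => /eqP ->.
  by rewrite mulr0.
(* Cauchy-Schwarz: expand the square of |y|^2 x - (x . y) y. *)
have := dot_ge0 (enorm y ^+ 2 *: x + (- dot x y) *: y).
rewrite dot_line !dotZl dotZr -!enorm_sqr.
set s := dot x y; set p := enorm x; set q := enorm y.
have q0 : 0 < q by rewrite lt0r y0 enorm_ge0.
have p0 : 0 <= p by exact: enorm_ge0.
have -> : q ^+ 2 * (q ^+ 2 * p ^+ 2) + (2 * - s * (q ^+ 2 * s) +
  (- s) ^+ 2 * q ^+ 2) = q ^+ 2 * ((p * q) ^+ 2 - s ^+ 2) by ring.
rewrite pmulr_rge0 ?exprn_gt0 // subr_ge0 => spq.
have pq0 : 0 <= p * q by rewrite mulr_ge0 // ltW.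
apply: le_trans (ler_norm s) _.
by rewrite -(ler_pXn2r (ltn0Sn 1)) ?nnegrE // real_normK ?num_real.
Qed.

Lemma enorm_triangle {R : realType} {N : nat} (x z : 'rV[R]_N) :
  enorm z <= enorm x + enorm (x - z).
Proof.
have pq0 : 0 <= enorm x + enorm (x - z) by rewrite addr_ge0 ?enorm_ge0.
rewrite -(ler_pXn2r (ltn0Sn 1)) ?nnegrE ?enorm_ge0 // sqrrD !enorm_sqr.
have {1 2}-> : z = x + (-1) *: (x - z).
  by rewrite scaleN1r opprB addrC subrK.
rewrite dot_line.
have := dot_le_enorm x (-1 *: (x - z)).
rewrite enormZ normrN1 mul1r dotZr.
set s := dot x (x - z); set p := enorm x * enorm (x - z) => sp.
by rewrite -subr_ge0; nra.
Qed.

(** * Topology of Euclidean balls and semicontinuity *)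

Lemma dot_continuous {R : realType} {N : nat} (z : 'rV[R]_N) :
  continuous (fun y : 'rV[R]_N => dot (y - z) (y - z)).
Proof.
apply: (@continuous_big R 'I_N +%R 0 xpredT add_continuous) => i _.
have ci : continuous (fun y : 'rV[R]_N => (y - z) 0 i : R).
  have -> : (fun y : 'rV[R]_N => (y - z) 0 i) = (fun y => y 0 i - z 0 i).
    by apply/funext => y; rewrite !mxE.
  move=> y.
  exact: (cvgB (@coord_continuous R 1 N 0 i y) (cvg_cst (z 0 i))).
by move=> y; exact: (cvgM (ci y) (ci y)).
Qed.

Lemma enorm_continuous {R : realType} {N : nat} (z : 'rV[R]_N) :
  continuous (fun y : 'rV[R]_N => enorm (y - z)).
Proof.
have -> : (fun y : 'rV[R]_N => enorm (y - z)) =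
    Num.sqrt \o (fun y => dot (y - z) (y - z)).
  by apply/funext => w /=; rewrite enormE.
move=> y; apply: continuous_comp; first exact: (dot_continuous z y).
exact: sqrt_continuous.
Qed.

(** The bornology is that of the sup norm, which the Euclidean norm dominates. *)
Lemma enorm_le_bounded {R : realType} {N : nat} (A : set 'rV[R]_N) (r : R) :
  (forall x, A x -> enorm x <= r) -> bounded_set A.
Proof.
move=> Ar; exists r; split; first exact: num_real.
move=> M rM x /Ar xr; apply: le_trans (ltW rM); apply: le_trans xr.
have [->|/mx_norm_neq0[[i j]]] := eqVneq `|x| 0; first exact: enorm_ge0.
by rewrite /= ord1 => xE; rewrite {1}/Num.norm /= xE; exact: entry_le_enorm.
Qed.

(** The ball is the union of its segments issued from the centre, hence it is
    connected. *)
Lemma eball0_domain {R : realType} {N : nat} (r : R) :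
  0 < r -> domain (eball0 r : set 'rV[R]_N).
Proof.
move=> r0.
split; last by exists 0; rewrite /eball0 /= enorm0.
  have -> : eball0 r = (fun y : 'rV[R]_N => enorm (y - 0)) @^-1` [set s | s < r].
    by apply/funext => y; rewrite /= subr0.
  apply: open_comp; last exact: open_lt.
  by move=> y _; exact: enorm_continuous.
have -> : eball0 r = \bigcup_(x in (eball0 r : set 'rV[R]_N))
    ((fun t : R => t *: x) @` `[0, 1]).
  apply/seteqP; split=> [x xr | y [x xr [t]]].
    exists x => //; exists 1; last by rewrite scale1r.
    by rewrite /= in_itv /= ler01 lexx.
  rewrite /= in_itv /= => /andP[t0 t1] <-.
  rewrite /eball0 /= enormZ ger0_norm //; apply: le_lt_trans xr.
  by rewrite ler_piMl // enorm_ge0.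
apply: bigcup_connected => [|x _].
  exists 0 => x _; exists 0; last by rewrite scale0r.
  by rewrite /= in_itv /= lexx ler01.
apply: connected_continuous_connected; first exact: segment_connected.
apply: continuous_subspaceT => t.
by apply: cvgZr_tmp; exact: cvg_id.
Qed.

Lemma continuous_lsc {R : realType} {N : nat} (Omega : set 'rV[R]_N)
    (u : 'rV[R]_N -> R) :
  continuous u -> lower_semicontinuous (EFin \o u : subspace Omega -> \bar R).
Proof.
move=> cu x a; rewrite /= lte_fin => ax.
have cx := @continuous_subspaceT _ _ Omega u cu x.
by exists [set y | a < u y]; [exact: (cvgr_gt _ cx _ ax) | move=> y].
Qed.

(** The sublevel sets of [f] in [K] generate a filter; any of its cluster points
    [p] is a minimum: near [p], [f] exceeds any given number below [f p]. *)
Lemma lsc_compact_min {T : topologicalType} {R : realType} (K : set T)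
    (f : T -> R) :
  compact K -> K !=set0 ->
  (forall x a, K x -> a < f x -> \forall y \near x, a < f y) ->
  exists2 p, K p & forall x, K x -> f p <= f x.
Proof.
move=> cK [x0 Kx0] lsc.
pose F := filter_from K (fun x => [set y | K y /\ f y <= f x]).
have FF : ProperFilter F.
  apply: filter_from_proper; last by move=> x Kx; exists x; split.
  apply: filter_from_filter => [|x y Kx Ky]; first by exists x0.
  have [xy|yx] := leP (f x) (f y).
    by exists x => // z [Kz zx]; split; split => //; exact: le_trans xy.
  by exists y => // z [Kz zy]; split; split => //; exact: le_trans zy (ltW yx).
have FK : F K by exists x0 => // y [].
have [p [Kp pF]] := cK F FF FK.
exists p => // x Kx; rewrite leNgt; apply/negP => xp.
have Fx : F [set y | K y /\ f y <= f x] by exists x.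
have [y [[_ yx]]] := pF _ _ Fx (lsc _ _ Kp xp).
by rewrite ltNge yx.
Qed.

(** * Failure of the minimum principles *)

(** The first-order term enters through a constant [h] of any sign, to
    serve for both |H| <= b |xi| and H = - b |xi|. *)
Lemma radial_supersolution_at {R : realType} {N k : nat} (phi u : 'rV[R]_N -> R)
    (x0 x : 'rV[R]_N) (H : 'rV[R]_N -> 'rV[R]_N -> R) (a C h : R) :
  (k < N)%N -> C2_near phi x -> touches_below phi u x ->
  let q y := dot (y - x0) (y - x0) - dot (x - x0) (x - x0) in
  (forall y, u y <= u x + a * q y + C * q y ^+ 2) ->
  (forall xi, H x xi <= h * enorm xi) ->
  k%:R * a + h * (`|a| * enorm (x - x0)) <= 0 ->
  Pminus_plus k H x (u x) (gradient phi x) (hessian phi x) <= 0.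
Proof.
move=> kN C2 [phix phiu] q uq Hle ale.
have [|gE Ple] := radial_touch_Pminus phi x0 x a C kN C2.
  by apply: filterS phiu => y yu; rewrite phix; apply: le_trans yu (uq y).
apply: le_trans (lerD Ple (Hle _)) _.
rewrite gE enormZ normrM (ger0_norm (ler0n R 2)).
have -> : k%:R * (2 * a) + h * (2 * `|a| * enorm (x - x0)) =
    2 * (k%:R * a + h * (`|a| * enorm (x - x0))) by ring.
by rewrite pmulr_rle0.
Qed.

(** The supersolution is a squared truncation: squaring makes it C^1, so that it
    lies below a second-order expansion, and the radius [rho <= k / (b + 1)] keeps
    b |x - x0| <= k wherever its derivative is nonzero. *)
Lemma strong_minimum_principle_fails {R : realType} {N k : nat}
    (Omega : set 'rV[R]_N) (H : 'rV[R]_N -> 'rV[R]_N -> R) (b : R) :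
  (1 <= k < N)%N -> domain Omega -> 0 <= b ->
  (forall x xi, Omega x -> H x xi <= b * enorm xi) ->
  ~ strong_minimum_principle (Pminus_plus k H) Omega.
Proof.
case/andP=> k1 kN [oOmega _ [x0 Ox0]] b0 Hle.
pose i0 : 'I_N := Ordinal (leq_ltn_trans (leq0n k) kN).
have [d d0 dP] := near_entrywise x0 Omega (open_nbhs_nbhs (conj oOmega Ox0)).
have kR : 0 < k%:R :> R by rewrite ltr0n.
have b1 : 0 < b + 1 by apply: ltr_wpDl.
pose rho := Num.min (d / 2) (k%:R / (b + 1)).
have rho0 : 0 < rho by rewrite lt_min !divr_gt0.
pose Q (y : 'rV[R]_N) : R := rho ^+ 2 - dot (y - x0) (y - x0).
pose u (y : 'rV[R]_N) : R := Num.max 0 (Q y) ^+ 2.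
have usuper : supersolution (Pminus_plus k H) Omega u.
  split.
    apply: continuous_lsc => y.
    have cQ : {for y, continuous Q}.
      exact: (cvgB (cvg_cst (rho ^+ 2)) (@dot_continuous R N x0 y)).
    have cm : {for y, continuous (fun z => Num.max 0 (Q z))}.
      have c0 : {for y, continuous (fun=> 0 : R)} by exact: cst_continuous.
      exact: (continuous_max c0 cQ).
    exact: (cvgM cm cm).
  move=> x Ox phi C2 touch.
  apply: (@radial_supersolution_at R N k phi u x0 x H (- 2 * Num.max 0 (Q x)) 1 b) => //.
  (* With s = Q x: max(0, s - q)^2 <= max(0, s)^2 - 2 max(0, s) q + q^2, for
     either sign of s and of s - q. *)
  - move=> y; set q := dot (y - x0) (y - x0) - _.
    have -> : u y = Num.max 0 (Q x - q) ^+ 2.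
      by rewrite /u /Q /q opprB addrA (addrAC (rho ^+ 2)) addrK.
    by rewrite /u; case: (leP 0 (Q x)) => Qx; case: (leP 0 (Q x - q)) => Qy; nra.
  - by move=> xi; exact: Hle.
  - have [Qx|Qx] := leP 0 (Q x); last first.
      by rewrite mulr0 normr0 mul0r !mulr0 addr0.
    rewrite normrM (ger0_norm Qx) normrN (ger0_norm (ler0n R 2)).
    have xr : enorm (x - x0) <= rho.
      rewrite -(ler_pXn2r (ltn0Sn 1)) ?nnegrE ?enorm_ge0 ?(ltW rho0) // enorm_sqr.
      by rewrite -subr_ge0.
    have rk : rho * (b + 1) <= k%:R by rewrite -ler_pdivlMr // ge_min lexx orbT.
    have : b * enorm (x - x0) <= k%:R.
      apply: le_trans rk; rewrite mulrC ler_pM ?enorm_ge0 //.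
      by rewrite lerDl.
    by move: Qx; set e := enorm _; set s := Q x; nra.
move=> /(_ u usuper)[x _|upos|u0]; first exact: sqr_ge0.
(* [x0 + v] is a point of the domain at distance d / 2 >= rho from [x0]. *)
- pose v : 'rV[R]_N := (d / 2) *: delta_mx 0 i0.
  have : Omega (x0 + v).
    apply: dP => i; rewrite !mxE; case: (_ && _); rewrite ?mulr1 ?mulr0 ?normr0 //.
    by rewrite gtr0_norm ?divr_gt0 // ltr_pdivrMr // ltr_pMr // ltr1n.
  move=> /upos; rewrite /u (_ : Num.max 0 _ = 0) ?expr0n ?ltxx //.
  apply/max_idPl; rewrite /Q addrAC subrr add0r subr_le0 /v dotZl dotZr dot_delta.
  rewrite mxE !eqxx mulr1 -expr2 ler_pXn2r ?nnegrE ?divr_ge0 ?(ltW d0) ?(ltW rho0) //.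
  by rewrite ge_min lexx.
- have /eqP := u0 _ Ox0; rewrite /u /Q subrr /dot big1 => [|i _]; last by rewrite mxE mul0r.
  by rewrite subr0 sqrf_eq0 max_r ?sqr_ge0 // sqrf_eq0 gt_eqF.
Qed.

(** The bottom of the well is the sphere of radius k / b, beyond which the
    gradient term beats the curvature of the spheres. *)
Lemma weak_minimum_principle_fails {R : realType} {N k : nat} (b r : R) :
  (k < N)%N -> 0 < b -> 0 < r -> k%:R < b * r ->
  ~ weak_minimum_principle
      (Pminus_plus k (fun _ xi => - (b * enorm xi))) (eball0 r : set 'rV[R]_N).
Proof.
move=> kN b0 r0 kbr.
pose m := (k%:R / b) ^+ 2.
have kb0 : 0 <= k%:R / b by rewrite divr_ge0 ?ler0n // ltW.
have kbltr : k%:R / b < r by rewrite ltr_pdivrMr // mulrC.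
have mr : m < r ^+ 2 by rewrite ltr_pXn2r ?nnegrE ?(ltW r0).
pose u (y : 'rV[R]_N) := (dot (y - 0) (y - 0) - m) ^+ 2 - (r ^+ 2 - m) ^+ 2.
have usuper : supersolution (Pminus_plus k (fun _ xi => - (b * enorm xi)))
    (eball0 r) u.
  split.
    apply: continuous_lsc => y.
    have cQ : {for y, continuous (fun y : 'rV[R]_N => dot (y - 0) (y - 0) - m)}.
      exact: (cvgB (@dot_continuous R N 0 y) (cvg_cst m)).
    exact: (cvgB (cvgM cQ cQ) (cvg_cst ((r ^+ 2 - m) ^+ 2))).
  move=> x xr phi C2 touch.
  apply: (@radial_supersolution_at R N k phi u 0 x _
    (2 * (dot (x - 0) (x - 0) - m)) 1 (- b)) => //.
  - by move=> y; rewrite le_eqVlt; apply/orP; left; apply/eqP; rewrite /u; ring.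
  - by move=> xi; rewrite mulNr.
  - rewrite -enorm_sqr; set e := enorm _; have e0 : 0 <= e := enorm_ge0 _.
    have bkb : b * (k%:R / b) = k%:R by rewrite mulrC divfK // gt_eqF.
    rewrite mulNr subr_le0.
    have [le_me|lt_em] := leP m (e ^+ 2).
      rewrite ger0_norm; last by rewrite mulr_ge0 // subr_ge0.
      rewrite mulrC mulrCA ler_wpM2l ?mulr_ge0 ?subr_ge0 //.
      rewrite -bkb ler_pM2l // -(ler_pXn2r (ltn0Sn 1)) ?nnegrE //.
    apply: (@le_trans _ _ 0).
      by rewrite mulr_ge0_le0 // mulr_ge0_le0 // subr_le0 ltW.
    by rewrite !mulr_ge0 // ltW.
have uliminf : (0 <= limf_einf (EFin \o u) (to_boundary (eball0 r)))%E.
  apply/lee_addgt0Pr => e e0; rewrite limf_einfE -leeBlDr // sub0e.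
  (* Within d of the sphere, r^2 - |x|^2 <= 2 r d, whence - u <= 4 r^3 d. *)
  pose d := Num.min r (e / (4 * r ^+ 3)).
  have d0 : 0 < d by rewrite lt_min r0 divr_gt0 ?mulr_gt0 ?exprn_gt0.
  pose V : set 'rV[R]_N := [set x | eball0 r x /\
    exists2 z, boundary (eball0 r) z & enorm (x - z) < d].
  have VF : to_boundary (eball0 r) V by exists d.
  suff infV : (- e%:E <= ereal_inf ((EFin \o u) @` V))%E.
    by apply: le_trans infV _; apply: ereal_sup_ubound; exists V.
  apply: le_ereal_inf_tmp => _ [x [xr [z [_ zr] xz]] <-] /=.
  have {}zr : r <= enorm z.
    have [oB _ _] := @eball0_domain R N r r0.
    rewrite leNgt; apply/negP => zlt; apply: zr.
    by apply: open_nbhs_nbhs; split.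
  have xd : r - d <= enorm x.
    by rewrite lerBlDr (le_trans zr) // (le_trans (enorm_triangle x z)) // lerD2l ltW.
  have dr : d <= r by rewrite ge_min lexx.
  have de : d * (4 * r ^+ 3) <= e.
    by rewrite -ler_pdivlMr ?mulr_gt0 ?exprn_gt0 // ge_min lexx orbT.
  rewrite lee_fin /u subr0 -enorm_sqr.
  move: xr xd; rewrite /eball0 /=; set t := enorm x => tr td.
  have t0 : 0 <= t := enorm_ge0 _.
  have m0 : 0 <= m by exact: sqr_ge0.
  have s1 : r ^+ 2 - t ^+ 2 <= 2 * r * d by nra.
  have s2 : 0 <= r ^+ 2 - t ^+ 2 by nra.
  have s3 : t ^+ 2 + r ^+ 2 - 2 * m <= 2 * r ^+ 2 by nra.
  have -> : (t ^+ 2 - m) ^+ 2 - (r ^+ 2 - m) ^+ 2 =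
    - ((r ^+ 2 - t ^+ 2) * (t ^+ 2 + r ^+ 2 - 2 * m)) by ring.
  rewrite lerN2; apply: le_trans de.
  apply: le_trans (ler_wpM2l s2 s3) _.
  have -> : d * (4 * r ^+ 3) = 2 * r * d * (2 * r ^+ 2) by ring.
  by rewrite ler_wpM2r // mulr_ge0 // sqr_ge0.
move=> /(_ u usuper uliminf ((k%:R / b) *: delta_mx 0 (Ordinal (leq_ltn_trans (leq0n k) kN)))).
rewrite /eball0 /u /= subr0 enormE dotZl dotZr dot_delta mxE !eqxx mulr1 -expr2.
rewrite sqrtr_sqr ger0_norm // => /(_ kbltr).
by rewrite -/m subrr expr0n sub0r oppr_ge0 leNgt exprn_gt0 // subr_gt0.
Qed.

(** * Weak minimum principle *)

Lemma is_derive_coord {R : realType} {N : nat} (y v : 'rV[R]_N) (j : 'I_N) :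
  is_derive y v (fun z : 'rV[R]_N => z 0 j : R) (v 0 j).
Proof.
have q : h^-1 *: (((fun z : 'rV[R]_N => z 0 j : R) \o shift y) (h *: v) - y 0 j)
    @[h --> (0 : R)^'] --> v 0 j.
  apply: cvg_near_cst; near=> h; rewrite /= !mxE addrK scalerA mulVf ?scale1r //.
  by near: h; exact: nbhs_dnbhs_neq.
by split; [apply/cvg_ex; exists (v 0 j) | exact: (@cvg_lim R^o)].
Unshelve. all: by end_near.
Qed.

Section Paraboloid.
Context {R : realType} {N : nat} (alpha c : R).
Let phi (y : 'rV[R]_N) : R := alpha * dot y y + c.

Let phi_derive (y v : 'rV[R]_N) : is_derive y v phi (2 * alpha * dot y v).
Proof.
have -> : phi = alpha \*: (\sum_j ((fun z : 'rV[R]_N => z 0 j : R) *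
    (fun z : 'rV[R]_N => z 0 j : R))) + cst c.
  by apply/funext => z; rewrite /phi /= fct_sumE.
have dj j := is_derive_coord y v j.
apply: is_derive_eq; rewrite addr0.
have -> : 2 * alpha * dot y v = alpha * (dot y v + dot y v) by ring.
by rewrite /dot -big_split.
Qed.

Let partial_phi j : partial j phi = fun y => 2 * alpha * y 0 j.
Proof.
apply/funext => y; have [_ E] := phi_derive y (delta_mx 0 j).
by rewrite /partial E dot_delta.
Qed.

Let partial2_derive (y v : 'rV[R]_N) j :
  is_derive y v (partial j phi) (2 * alpha * v 0 j).
Proof.
rewrite partial_phi.
exact: (is_deriveZ (2 * alpha) (is_derive_coord y v j)).
Qed.

Let partial2_phi i j : partial i (partial j phi) =
  fun=> 2 * alpha * (delta_mx 0 i : 'rV[R]_N) 0 j.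
Proof. by apply/funext => y; have [_] := partial2_derive y (delta_mx 0 i) j. Qed.

Lemma paraboloid_C2 x : C2_near phi x.
Proof.
apply: filterE => y; split.
- have dc := @dot_continuous R N 0.
  have -> : phi = fun y => alpha * dot (y - 0) (y - 0) + c.
    by apply/funext => z; rewrite subr0.
  exact: (cvgD (cvgM (cvg_cst alpha) (dc y)) (cvg_cst c)).
- move=> i; split; first by have [] := phi_derive y (delta_mx 0 i).
  rewrite partial_phi.
  exact: (cvgM (cvg_cst (2 * alpha)) (@coord_continuous R 1 N 0 i y)).
- move=> i j; split; first by have [] := partial2_derive y (delta_mx 0 i) j.
  by rewrite partial2_phi; exact: cst_continuous.
Qed.

Lemma paraboloid_gradient x : gradient phi x = (2 * alpha) *: x.
Proof. by apply/rowP => i; rewrite !mxE partial_phi. Qed.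

Lemma paraboloid_hessian x : hessian phi x = (2 * alpha)%:M.
Proof.
apply/matrixP => i j; rewrite !mxE partial2_phi mxE eqxx /= eq_sym.
by rewrite mulr_natr.
Qed.

End Paraboloid.

(** Let - m < 0 be a value of [u].  As [u >= - m / 2] near the boundary,
    subtracting alpha |x|^2 <= m / 2 is too little to push the minimum out of a
    compact subset [K] of the domain. *)
Lemma weak_minimum_principle_holds {R : realType} {N k : nat}
    (Omega : set 'rV[R]_N) (H : 'rV[R]_N -> 'rV[R]_N -> R) (b r : R) :
  (1 <= k <= N)%N -> open Omega -> 0 < r -> Omega `<=` eball0 r ->
  0 <= b -> b * r <= k%:R ->
  (forall x xi, Omega x -> - (b * enorm xi) <= H x xi) ->
  weak_minimum_principle (Pminus_plus k H) Omega.
Proof.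
case/andP=> k1 kN oOmega r0 Or b0 brk Hge u [lsc_u visc] liminf x1 Ox1.
rewrite leNgt; apply/negP => ux1.
pose m := - u x1; have m0 : 0 < m by rewrite oppr_gt0.
have [d d0 dV] : exists2 d : R, 0 < d & forall y, Omega y ->
    (exists2 z, boundary Omega z & enorm (y - z) < d) -> - (m / 2) <= u y.
  have : ((- (m / 2))%:E < limf_einf (EFin \o u) (to_boundary Omega))%E.
    by apply: lt_le_trans liminf; rewrite lte_fin oppr_lt0 divr_gt0.
  rewrite limf_einfE => /ereal_sup_gt[_ [V [d /= d0 dV] <-] ltV].
  exists d => // y Oy yz; rewrite -lee_fin; apply: ltW; apply: lt_le_trans ltV _.
  by apply: ereal_inf_lbound; exists y => //; apply: dV.
pose alpha := m / (2 * r ^+ 2).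
have alpha0 : 0 < alpha by rewrite divr_gt0 // mulr_gt0 // exprn_gt0.
have alphar : alpha * r ^+ 2 = m / 2.
  by rewrite /alpha; field; rewrite gt_eqF.
pose v y := u y - alpha * dot y y.
pose K : set 'rV[R]_N := [set y | [/\ enorm (y - 0) <= r, closure Omega y &
  forall z, boundary Omega z -> d <= enorm (y - z)]].
(* Points of the closure that stay at distance d from the boundary are interior. *)
have KO y : K y -> Omega y.
  case=> _ cy bd; apply: interior_subset; apply: contrapT => iy.
  by have := bd y (conj cy iy); rewrite subrr enorm0 leNgt d0.
have cK : compact K.
  apply: bounded_closed_compact.
    by apply: (enorm_le_bounded K r) => y []; rewrite subr0.
  have -> : K = [set y | enorm (y - 0) <= r] `&` closure Omega `&`
      \bigcap_(z in boundary Omega) [set y | d <= enorm (y - z)].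
    by apply/seteqP; split=> y; [case=> y1 y2 y3; split | case=> [[y1 y2] y3]; split].
  apply: closedI; first apply: closedI.
  - apply: (@closed_comp _ _ (fun y : 'rV[R]_N => enorm (y - 0)) [set s | s <= r]).
      by move=> y _; exact: enorm_continuous.
    exact: closed_le.
  - exact: closed_closure.
  - apply: closed_bigI => z _.
    apply: (@closed_comp _ _ (fun y : 'rV[R]_N => enorm (y - z)) [set s | d <= s]).
      by move=> y _; exact: enorm_continuous.
    exact: closed_ge.
have notK y : Omega y -> ~ K y -> - (m / 2) <= u y.
  move=> Oy nKy; apply: dV => //; apply: contrapT => nz; apply: nKy; split.
  - by rewrite subr0 ltW //; exact: Or.
  - exact: subset_closure.
  - move=> z bz; rewrite leNgt; apply/negP => yz; apply: nz.
    by exists z.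
have Kx1 : K x1.
  apply: contrapT => /(notK _ Ox1); rewrite -[u x1]opprK -/m lerN2 leNgt.
  by rewrite ltr_pdivrMr // ltr_pMr // ltr1n.
have dotr y : Omega y -> 0 <= alpha * dot y y <= m / 2.
  move=> /Or yr; rewrite mulr_ge0 ?dot_ge0 ?(ltW alpha0) //= -alphar ler_pM2l //.
  by rewrite -enorm_sqr ler_pXn2r ?nnegrE ?enorm_ge0 ?(ltW r0) // ltW.
have [|p Kp pmin] := @lsc_compact_min _ R K v cK (ex_intro _ x1 Kx1).
  move=> x a Kx avx; have Ox := KO x Kx.
  pose e := (v x - a) / 2.
  have e0 : 0 < e by rewrite divr_gt0 // subr_gt0.
  have : (((u x - e)%:E) < (EFin \o u) x)%E by rewrite lte_fin gtrBl.
  move=> /lsc_u[V Vx VP].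
  have {}Vx : nbhs x V.
    have iOx : (interior Omega) x by exact: open_nbhs_nbhs (conj oOmega Ox).
    by rewrite (nbhs_subspace_interior iOx).
  have : \forall y \near x, alpha * dot (y - 0) (y - 0) < alpha * dot x x + e.
    have cq : {for x, continuous (fun y : 'rV[R]_N => alpha * dot (y - 0) (y - 0))}.
      exact: (cvgM (cvg_cst alpha) (@dot_continuous R N 0 x)).
    by apply: (cvgr_lt _ cq); rewrite subr0 ltrDl.
  apply: filterS2 Vx => y /VP; rewrite lte_fin /= subr0 => uy qy.
  by move: uy qy; rewrite /v /e /v; lra.
have Op := KO p Kp.
have vp y : Omega y -> v p <= v y.
  move=> Oy; have [/pmin //|/(notK y Oy) uy] := pselect (K y).
  apply: le_trans (pmin x1 Kx1) _; rewrite /v.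
  have /andP[q1 _] := dotr x1 Ox1; have /andP[_ q2] := dotr y Oy.
  by move: uy q1 q2; rewrite /m; lra.
pose c := u p - alpha * dot p p.
have := visc p Op _ (paraboloid_C2 alpha c p).
rewrite paraboloid_gradient paraboloid_hessian /Pminus_plus Pminus_scalar //.
suff touch : touches_below (fun y => alpha * dot y y + c) u p.
  move=> /(_ touch); apply/negP; rewrite -ltNge.
  apply: lt_le_trans (_ : 0 < k%:R * (2 * alpha) - b * enorm ((2 * alpha) *: p)) _.
    have a20 : 0 < 2 * alpha by rewrite mulr_gt0.
    rewrite enormZ gtr0_norm //.
    have -> : k%:R * (2 * alpha) - b * (2 * alpha * enorm p) =
      2 * alpha * (k%:R - b * enorm p) by ring.
    rewrite pmulr_rgt0 // subr_gt0; have pr := Or p Op.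
    have [->|bn0] := eqVneq b 0; first by rewrite mul0r ltr0n.
    by apply: lt_le_trans brk; rewrite ltr_pM2l // lt0r bn0.
  by rewrite lerD2l; exact: Hge.
split.
- by rewrite /c addrC subrK.
- apply: filterS (open_nbhs_nbhs (conj oOmega Op)) => y /vp.
  by rewrite /v -/c => vy; rewrite addrC -lerBrDr.
Qed.

Theorem proposition2p4 (R : realType) (N k : nat)
    (hN : (2 <= N)%N) (hk : (1 <= k < N)%N) :
  (forall (Omega : set 'rV[R]_N) (H : 'rV[R]_N -> 'rV[R]_N -> R) (b : R),
     domain Omega -> bounded_set Omega ->
     {within Omega `*` [set: 'rV[R]_N], continuous (fun p => H p.1 p.2)} ->
     0 <= b ->
     (forall x xi, Omega x -> `|H x xi| <= b * enorm xi) ->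
     ~ strong_minimum_principle (Pminus_plus k H) Omega /\
     (forall r : R, 0 < r -> Omega `<=` eball0 r -> b * r <= k%:R ->
        weak_minimum_principle (Pminus_plus k H) Omega)) /\
  (forall b r : R, 0 < b -> 0 < r -> k%:R < b * r ->
     exists Omega : set 'rV[R]_N,
       [/\ domain Omega, bounded_set Omega, Omega `<=` eball0 r &
           ~ weak_minimum_principle
               (Pminus_plus k (fun _ xi => - (b * enorm xi))) Omega]).
Proof.
have /andP[k1 kN] := hk.
split=> [U H b dU _ _ b0 Hb|b r b0 r0 kbr].
  split=> [|r r0 Or brk].
    apply: (@strong_minimum_principle_fails R N k U H b) => // x xi Ox.
    exact: le_trans (ler_norm _) (Hb x xi Ox).
  have [oU _ _] := dU.
  apply: (@weak_minimum_principle_holds R N k U H b r) => //.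
    by rewrite k1 ltnW.
  by move=> x xi Ox; have := Hb x xi Ox; rewrite ler_norml => /andP[].
exists (eball0 r); split=> //.
- exact: eball0_domain.
- by apply: (enorm_le_bounded _ r) => x; rewrite /eball0 /=; exact: ltW.
- exact: weak_minimum_principle_fails.
Qed.
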